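(* Let $n,m\ge1$ and let $T$ be a triangulation of the annulus $A_{n,m}$, with outer quiddity sequence $q$ (of length $n$) and inner quiddity sequence $\bar q$ (of length $m$). Let $\mathcal{F}=(m_{i,j})$ and $\bar{\mathcal{F}}=(\bar m_{i,j})$ be the associated outer and inner friezes, i.e. the periodic infinite friezes of positive integers generated by $q$ and $\bar q$. Then $s_q=s_{\bar q}$.
   Context: An infinite frieze of positive integers is an array $(m_{i,j})$, indexed by $i\in\mathbb{Z}$ and $j\ge i-2$, with $m_{i,i-2}=0$, $m_{i,i-1}=1$, with $m_{i,j}$ a positive integer for $j\ge i-1$, and with $m_{i,j}m_{i+1,j+1}-m_{i,j+1}m_{i+1,j}=1$ for all $i$ and all $j\ge i-1$. Its quiddity row is $(a_i)_{i\in\mathbb{Z}}$, $a_i=m_{i,i}$, which determines the frieze (via $m_{i,j}=a_jm_{i,j-1}-m_{i,j-2}$). A finite sequence $q=(a_1,\dots,a_n)$ generates the frieze whose quiddity row is the $n$-periodic repetition of $q$. For such $q$ put $s_q:=m_{1,n}-m_{2,n-1}$; likewise $s_{\bar q}:=\bar m_{1,m}-\bar m_{2,m-1}$ for $\bar q$ of length $m$. The sequences $q$, $\bar q$ are taken exactly as they come from the triangulation (of lengths $n$ and $m$), irrespective of their minimal periods. $A_{n,m}$ is the annulus with $n$ marked points on its outer boundary and $m$ marked points on its inner boundary. A triangulation is a maximal collection of pairwise non-crossing (non-self-crossing) arcs, up to isotopy, with endpoints at marked points, none of which is contractible or isotopic to a boundary segment; loops are allowed. Label the vertices of the outer and inner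 boundaries anti-clockwise by $1,\dots,n$ and $1,\dots,m$. The outer quiddity sequence is $q=(a_1,\dots,a_n)$, where $a_i$ is the number of triangles incident with the outer vertex $i$, counted locally (in a small neighbourhood of the vertex, i.e. $a_i$ is one plus the number of ends of arcs of $T$ at vertex $i$). The inner quiddity sequence $\bar q=(\bar a_1,\dots,\bar a_m)$ is defined in the same way from the inner vertices. It is known that both $q$ and $\bar q$ generate infinite friezes of positive integers. *)

(* Defs.v *)
From mathcomp Require Import all_boot all_order all_algebra.
From mathcomp Require Import finmap classical_sets cardinality.

Set Implicit Arguments.
Unset Strict Implicit.
Unset Printing Implicit Defensive.

Import Order.TTheory GRing.Theory Num.Theory.
Local Open Scope classical_set_scope.
Local Open Scope ring_scope.

(* Isotopy classes of arcs of the annulus A_{n,m} are described through the   *)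
(* universal cover of the annulus, the infinite strip R x [0,1]. The outer    *)
(* boundary unrolls to R x {0} and the inner one to R x {1}, the angle being  *)
(* the first coordinate, so that anti-clockwise labels increase from left to  *)
(* right on both lines.                                                       *)

(* Outer i (resp. Inner i) is a lift of the outer (inner) marked point whose  *)
(* label is congruent to i modulo n (modulo m).                               *)
Definition strip_point : choiceType := (int + int)%type.
Definition Outer (i : int) : strip_point := inl i.
Definition Inner (i : int) : strip_point := inr i.

(* The order in which one meets the marked points when walking once around    *)
(* the boundary of the strip: the outer line from left to right, then the     *)
(* inner line from right to left.                                             *)
Definition before (p q : strip_point) : bool :=
  match p, q with
  | inl i, inl j => i < j
  | inl _, inr _ => true
  | inr _, inl _ => false
  | inr i, inr j => j < i
  end.

(* A curve in the strip is determined up to homotopy by its unordered pair of *)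
(* endpoints; the latter is written (p, q) with before p q. The condition     *)
(* before p q also excludes contractible loops, whose lifts are closed.       *)
Definition strip_arc : choiceType := (strip_point * strip_point)%type.

(* The strip is a disc: two curves have to cross exactly when their endpoints *)
(* strictly alternate along its boundary.                                     *)
Definition cross (a b : strip_arc) : bool :=
  [&& before a.1 b.1, before b.1 a.2 & before a.2 b.2]
  || [&& before b.1 a.1, before a.1 b.2 & before b.2 a.2].

Definition boundary_segment (a : strip_arc) : Prop :=
  exists i : int, a = (Outer i, Outer (i + 1)) \/ a = (Inner (i + 1), Inner i).

(* The action of z in Z, the group of deck transformations of the cover: one  *)
(* turn around the annulus moves the outer labels by n and the inner ones     *)
(* by m.                                                                      *)
Definition deck_point (n m : nat) (z : int) (p : strip_point) : strip_point :=
  match p with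
  | inl i => Outer (i + z * n%:Z)
  | inr i => Inner (i + z * m%:Z)
  end.

Definition deck (n m : nat) (z : int) (a : strip_arc) : strip_arc :=
  (deck_point n m z a.1, deck_point n m z a.2).

(* The arcs of the annulus that have a and b as lifts cross.                  *)
Definition annulus_cross (n m : nat) (a b : strip_arc) : Prop :=
  exists z : int, cross a (deck n m z b).

Definition annulus_arc (n m : nat) (a : strip_arc) : Prop :=
  [/\ before a.1 a.2, ~ boundary_segment a & ~ annulus_cross n m a a].

(* A collection of arcs of the annulus is given by the set of all the lifts   *)
(* of its members.                                                            *)
Definition noncrossing_collection (n m : nat) (T : set strip_arc) : Prop :=
  [/\ forall a, T a -> annulus_arc n m a,
      forall a z, T a -> T (deck n m z a) &
      forall a b, T a -> T b -> ~ annulus_cross n m a b].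

Definition triangulation (n m : nat) (T : set strip_arc) : Prop :=
  noncrossing_collection n m T /\
  forall T' : set strip_arc, noncrossing_collection n m T' -> T `<=` T' -> T' = T.

(* Each end of an arc at a marked point has exactly one lift at a given lift  *)
(* p of that point (a loop has two lifts at p, one for each of its ends).     *)
Definition arc_ends (T : set strip_arc) (p : strip_point) : set strip_arc :=
  [set a | T a /\ (a.1 = p \/ a.2 = p)].

(* k arc ends cut a small half-disc around the vertex into k + 1 sectors, each *)
(* lying in a triangle. (fset_set A is empty for an infinite A; arc_ends T p   *)
(* is finite when T is a triangulation.)                                       *)
Definition triangles_at (T : set strip_arc) (p : strip_point) : nat :=
  (#|` fset_set (arc_ends T p)|).+1.

Definition outer_quiddity (n : nat) (T : set strip_arc) : seq nat :=
  [seq triangles_at T (Outer i%:Z) | i <- iota 1 n].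

Definition inner_quiddity (m : nat) (T : set strip_arc) : seq nat :=
  [seq triangles_at T (Inner i%:Z) | i <- iota 1 m].

(* Only the values F i j with i - 2 <= j are meaningful.                      *)
Definition infinite_frieze (F : int -> int -> int) : Prop :=
  [/\ forall i, F i (i - 2) = 0,
      forall i, F i (i - 1) = 1,
      forall i j, i - 1 <= j -> 0 < F i j &
      forall i j, i - 1 <= j ->
        F i j * F (i + 1) (j + 1) - F i (j + 1) * F (i + 1) j = 1].

(* q = (a_1, ..., a_l) is indexed from 0 as a sequence: a_i is nth 0 q (i-1). *)
Definition generates (q : seq nat) (F : int -> int -> int) : Prop :=
  infinite_frieze F /\
  forall i : int, F i i = (nth 0%N q `|((i - 1) %% (size q)%:Z)%Z|%N)%:Z.

Definition frieze_s (q : seq nat) (F : int -> int -> int) : int :=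
  F 1 (size q)%:Z - F 2 ((size q)%:Z - 1).

(* Main.v *)
(* Let a be the quiddity row of F. The solutions of f (i + 1) = a i f i -     *)
(* f (i - 1) form a plane on which the shift by n acts with determinant 1 and *)
(* trace s_q, so that f (i + 2n) + f i = s_q f (i + n). Along each bridging   *)
(* arc (x, y) an outer solution f determines an inner solution g, through     *)
(* relations counting the triangles around x and y. These relations propagate *)
(* across the triangles having vertices on both boundaries, so the inner      *)
(* solution is the same for all bridging arcs, and f |-> g commutes with the  *)
(* deck transformation. Hence g (y + 2m) + g y equals both s_q g (y + m) and  *)
(* s_qbar g (y + m), and f can be chosen so that g (y + m) = 1.               *)
Require Import Defs.
From mathcomp Require Import all_boot all_order all_algebra.
From mathcomp Require Import finmap classical_sets cardinality boolp.
From mathcomp Require Import zify ring lra.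

Set Implicit Arguments.
Unset Strict Implicit.
Unset Printing Implicit Defensive.

Import Order.TTheory GRing.Theory Num.Theory.
Local Open Scope classical_set_scope.
Local Open Scope ring_scope.

(** * Solutions of the quiddity recurrence *)

(** Both sides are traces of conjugate monodromies. One turn around the annulus acts with
    determinant 1 on the plane of solutions of each quiddity recurrence, and [solution_trace]
    identifies its trace with [frieze_s]; so it suffices to intertwine the two actions. [polygon]
    eliminates the peripheral arcs: next to the ends of an edge, a solution is determined by its
    values at these ends and by arc counts. Hence in a triangle with outer vertices [x], [x'] and
    inner vertex [y], the first relation of [compatible] at [(x, y)] amounts to [f x' = f x + g y],
    and [compatible] passes on to [(x', y)] ([compatible_step]). Iterating up to the translate by
    one turn ([compatible_chain]) gives equivariance. Maximality of the triangulation supplies a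
    bridging arc ([maximal_bridge]) and a triangle to the right of each one ([maximal_step]). *)

Definition solution (a f : int -> int) : Prop :=
  forall i : int, f (i + 1) = a i * f i - f (i - 1).

Lemma solution_zero (a f : int -> int) (k : int) :
  solution a f -> f k = 0 -> f (k + 1) = 0 -> forall i, f i = 0.
Proof.
move=> fS fk fk1.
have up (p : nat) : f (k + p%:Z) = 0 /\ f (k + p%:Z + 1) = 0.
  elim: p => [|p [IH1 IH2]]; first by rewrite addr0.
  have -> : k + p.+1%:Z = k + p%:Z + 1 by lia.
  by split=> //; rewrite fS addrK IH1 IH2 mulr0 subr0.
have down (p : nat) : f (k - p%:Z) = 0 /\ f (k - p%:Z + 1) = 0.
  elim: p => [|p [IH1 IH2]]; first by rewrite subr0.
  have -> : k - p.+1%:Z = k - p%:Z - 1 by lia.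
  rewrite subrK; split=> //; have := fS (k - p%:Z).
  by rewrite IH1 IH2 mulr0 sub0r => /esym/eqP; rewrite oppr_eq0 => /eqP.
move=> i; have [le_ki|lt_ik] := lerP k i.
  by rewrite (_ : i = k + (`|i - k|%N)%:Z); [apply: (up _).1 | lia].
by rewrite (_ : i = k - (`|k - i|%N)%:Z); [apply: (down _).1 | lia].
Qed.

Lemma solution_exists (a : int -> int) (k u v : int) :
  exists f, [/\ solution a f, f k = u & f (k + 1) = v].
Proof.
(* The pairs hold the values at [k + p] and [k + p + 1] for [up], at [k - p] and [k - p + 1] for
   [down]. *)
pose up := fix up (p : nat) : int * int := if p is p'.+1 then
  ((up p').2, a (k + p%:Z) * (up p').2 - (up p').1) else (u, v).
pose down := fix down (p : nat) : int * int := if p is p'.+1 then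
  (a (k - p'%:Z) * (down p').1 - (down p').2, (down p').1) else (u, v).
pose f (i : int) : int := if k <= i then (up `|i - k|%N).1 else (down `|k - i|%N).1.
have f_up (p : nat) : f (k + p%:Z) = (up p).1.
  by rewrite /f ifT; [congr (up _).1|]; lia.
have f_down (p : nat) : f (k - p%:Z) = (down p).1.
  case: p => [|p]; first by rewrite subr0 -[k]addr0 (f_up 0%N).
  by rewrite /f ifF; [congr (down _).1|]; lia.
have f_k : f k = u by rewrite -[k in f k]addr0 (f_up 0%N).
have f_k1 : f (k + 1) = v by rewrite (f_up 1%N).
exists f; split=> // i; have [lt_ki|] := ltrP k i; last rewrite le_eqVlt => /predU1P[->|lt_ik].
- have [p ->] : exists p : nat, i = k + p.+1%:Z by exists (`|i - k|%N).-1; lia.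
  have -> : k + p.+1%:Z + 1 = k + p.+2%:Z by lia.
  have -> : k + p.+1%:Z - 1 = k + p%:Z by lia.
  by rewrite !f_up.
- by rewrite f_k1 f_k (f_down 1%N) /= subr0 subKr.
- have [p ->] : exists p : nat, i = k - p.+1%:Z by exists (`|k - i|%N).-1; lia.
  have -> : k - p.+1%:Z + 1 = k - p%:Z by lia.
  have -> : k - p.+1%:Z - 1 = k - p.+2%:Z by lia.
  by rewrite !f_down /= subKr.
Qed.

(** By induction the recurrence holds in row [i + 1]; two consecutive unimodular rules carry it to
    row [i], after cancelling an entry that is nonzero by positivity. *)
Lemma frieze_rec (F : int -> int -> int) (i : int) (p : nat) :
  infinite_frieze F ->
  F i (i + p%:Z) = F (i + p%:Z) (i + p%:Z) * F i (i + p%:Z - 1) - F i (i + p%:Z - 2).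
Proof.
move=> [F2 F1 Fpos Funi]; elim: p i => [|p IH] i.
  by rewrite addr0 F1 F2 mulr1 subr0.
have {IH} := IH (i + 1).
set j := i + 1 + p%:Z; have -> : i + p.+1%:Z = j by lia.
move=> IH.
have /eqP := Funi i (j - 1) ltac:(lia); rewrite subrK => /eqP U1.
have := Funi i (j - 2) ltac:(lia); rewrite (_ : j - 2 + 1 = j - 1); last by lia.
move=> U2.
have pos := Fpos (i + 1) (j - 1) ltac:(lia).
apply: (mulIf (lt0r_neq0 pos)); rewrite mulrBl.
rewrite IH in U1.
lra.
Qed.

(* Cayley-Hamilton for the shift by n acting on solutions: rows 1 and 2 of    *)
(* the frieze are fundamental solutions, f (j + 1) = f 1 * F 1 j - f 0 * F 2 j. *)
Lemma solution_trace (a f : int -> int) (F : int -> int -> int) (n : nat) :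
  (0 < n)%N -> infinite_frieze F -> (forall i, F i i = a i) ->
  (forall i, a (i + n%:Z) = a i) -> solution a f ->
  forall i, f (i + n%:Z + n%:Z) + f i = (F 1 n%:Z - F 2 (n%:Z - 1)) * f (i + n%:Z).
Proof.
move=> n0 Ffr Fa aper fS; have [F2 F1 _ Funi] := Ffr.
have span (g : int -> int) (p : nat) : solution a g ->
  g (p%:Z + 1) = g 1 * F 1 p%:Z - g 0 * F 2 p%:Z /\
  g (p%:Z + 1 + 1) = g 1 * F 1 (p%:Z + 1) - g 0 * F 2 (p%:Z + 1).
  move=> gS; elim: p => [|p [IH1 IH2]].
    have F10 : F 1 0 = 1 by exact: (F1 1).
    have F20 : F 2 0 = 0 by exact: (F2 2).
    have F21 : F 2 1 = 1 by exact: (F1 2).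
    rewrite !add0r gS subrr F10 F20 F21 Fa.
    by split; lra.
  have -> : p.+1%:Z = p%:Z + 1 by lia.
  split=> //; rewrite gS addrK IH1 IH2.
  have := frieze_rec 1 p.+1 Ffr; rewrite (_ : 1 + p.+1%:Z = p%:Z + 1 + 1); last by lia.
  have := frieze_rec 2 p Ffr; rewrite (_ : 2 + p%:Z = p%:Z + 1 + 1); last by lia.
  have -> : p%:Z + 1 + 1 - 1 = p%:Z + 1 by lia.
  have -> : p%:Z + 1 + 1 - 2 = p%:Z by lia.
  move=> -> ->; rewrite Fa; ring.
have [q n_q] : exists q : nat, n%:Z = q%:Z + 1 by exists n.-1; lia.
(* With [q = n - 1], this says that the shift by [n] has determinant 1 in the coordinates [f 0],
   [f 1]. *)
have U := Funi 1 q%:Z ltac:(lia); rewrite -n_q in U.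
pose s := F 1 n%:Z - F 2 (n%:Z - 1).
(* The defect [h] is again a solution because [a] is periodic, so two consecutive zeros make it
   vanish. *)
pose h i := f (i + n%:Z + n%:Z) + f i - s * f (i + n%:Z).
have fS1 : solution a (fun i => f (i + n%:Z)).
  by move=> i; rewrite addrAC fS aper addrAC.
have hS : solution a h.
  move=> i; rewrite /h.
  have := fS1 (i + n%:Z); have := fS1 i; have := fS i; rewrite aper.
  rewrite -!(addrAC _ n%:Z) => -> -> ->; ring.
have [E0 E1] := span f q fS; have [E2 E3] := span _ q fS1.
rewrite -n_q in E0 E1 E2 E3.
have q_n : q%:Z = n%:Z - 1 by lia.
rewrite q_n ![_ + 1 + n%:Z]addrAC in E0 E1 E2 E3 U; rewrite -q_n in E0 E1 E2 E3 U.
rewrite add0r [1 + n%:Z]addrC in E2 E3; rewrite -[1 + 1]/2 in U.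
have h0 : h 0 = 0.
  rewrite /h /s !add0r -q_n E2 E1 E0.
  by have := congr1 ( *%R (f 0)) U; lra.
have h1 : h (0 + 1) = 0.
  rewrite /h /s add0r [1 + n%:Z]addrC [_ + 1 + _]addrAC -q_n E3 E1 E0.
  by have := congr1 ( *%R (f 1)) U; lra.
move=> i; have := solution_zero hS h0 h1 i.
by rewrite /h /s; lra.
Qed.

(** * Polygons cut off by peripheral arcs *)

Definition card (K : choiceType) (A : set K) : int := (#|` fset_set A|)%:Z.

Lemma eq_card (K : choiceType) (A B : set K) : (forall x, A x <-> B x) -> card A = card B.
Proof. by move=> AB; congr card; apply/funext => x; apply/propext. Qed.

Lemma card_split (K : choiceType) (C A B : set K) : finite_set C ->
  (forall x, C x <-> A x \/ B x) -> (forall x, A x -> B x -> False) ->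
  card C = card A + card B.
Proof.
move=> Cfin CAB AB0.
have Afin : finite_set A by apply: sub_finite_set Cfin => x ?; apply/CAB; left.
have Bfin : finite_set B by apply: sub_finite_set Cfin => x ?; apply/CAB; right.
rewrite (eq_card (B := A `|` B)) // /card fset_setU // cardfsU.
suff -> : (fset_set A `&` fset_set B = fset0)%fset by rewrite cardfs0 subn0.
rewrite -fset_setI // -fset_set0; congr fset_set.
by apply/funext => x; apply/propext; split=> // -[] /AB0.
Qed.

Lemma card_pred1 (K : choiceType) (x : K) (A : set K) : (forall y, A y <-> y = x) -> card A = 1.
Proof.
by move=> Ax; rewrite (eq_card (B := [set x])) // /card fset_set1 cardfs1.
Qed.

Lemma card_image (K K' : choiceType) (h : K -> K') (A : set K) :
  injective h -> finite_set A -> card (h @` A) = card A.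
Proof. by move=> hI Af; rewrite /card fset_set_image // card_imfset. Qed.

Lemma card_shift (d : int) (A B : set int) : finite_set B ->
  (forall i, A (i + d) <-> B i) -> card A = card B.
Proof.
move=> Bfin AB; rewrite -[RHS](card_image (h := fun i => i + d)) //; last by move=> ? ? /addIr.
apply: eq_card => i /=; split=> [Ai|[k Bk <-]]; last exact/AB.
by exists (i - d); rewrite ?subrK //; apply/AB; rewrite subrK.
Qed.

Lemma finite_int_interval (A : set int) (l u : int) :
  (forall i, A i -> l <= i /\ i <= u) -> finite_set A.
Proof.
move=> Alu; pose s : seq int := [seq l + k%:Z | k <- iota 0 `|(u - l + 1)%R|%N].
apply: (@sub_finite_set _ _ [set` s]); last exact: finite_seq.
move=> i /Alu lu /=; apply/mapP; exists `|i - l|%N; last lia.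
by rewrite mem_iota; lia.
Qed.

(** Sides of triangles: [E] holds arcs only, so the boundary segments are added. *)
Definition edge (E : int -> int -> Prop) (i j : int) : Prop := E i j \/ j = i + 1.

Definition rdeg (E : int -> int -> Prop) (i j : int) : int := card [set k | E i k /\ k <= j].
Definition ldeg (E : int -> int -> Prop) (i j : int) : int := card [set k | E k j /\ i <= k].

(** Models the lifts of the peripheral arcs at one boundary. An arc wider than [n] would cross its
    translate by one turn; width [n] is a loop. [nested_apex] gives the triangle under an arc. *)
Record nested (n : nat) (E : int -> int -> Prop) : Prop := Nested {
  nested_lt : forall i j, E i j -> i + 1 < j;
  nested_le : forall i j, E i j -> j <= i + n%:Z;
  nested_per : forall i j, E (i + n%:Z) (j + n%:Z) <-> E i j;
  nested_nc : forall i j p q, E i j -> E p q -> i < p -> p < j -> j < q -> False;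
  nested_apex : forall i j, E i j -> exists k, [/\ i < k, k < j, edge E i k & edge E k j]
}.

Lemma edge_lt n E i j : nested n E -> edge E i j -> i < j.
Proof. by move=> nE [/(nested_lt nE)|]; lia. Qed.

Lemma nested_finr n E i : nested n E -> finite_set [set k | E i k].
Proof.
move=> nE; apply: (@finite_int_interval _ i (i + n%:Z)) => k /= Eik.
by have := nested_lt nE Eik; have := nested_le nE Eik; lia.
Qed.

Lemma nested_finl n E i : nested n E -> finite_set [set k | E k i].
Proof.
move=> nE; apply: (@finite_int_interval _ (i - n%:Z) i) => k /= Eki.
by have := nested_lt nE Eki; have := nested_le nE Eki; lia.
Qed.

(* The sums say that f k = f i + f j for the apex k of the triangle under the *)
(* edge from i to j.                                                          *)
Lemma polygon n E a f i j : nested n E -> solution a f -> edge E i j ->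
  (forall k, i < k -> k < j -> a k = 1 + card [set l | E k l] + card [set l | E l k]) ->
  f (i + 1) = f j + rdeg E i j * f i /\ f (j - 1) = f i + ldeg E i j * f j.
Proof.
move=> nE fS; have [p] := ubnP `|j - i|%N; elim: p i j => // p IH i j.
rewrite ltnS => le_p edge_ij a_deg.
have [Eij|ji1] := pselect (E i j); last first.
  have {edge_ij}-> : j = i + 1 by case: edge_ij.
  have -> : rdeg E i (i + 1) = 0.
    rewrite /rdeg /card [X in fset_set X](_ : _ = set0) ?fset_set0 //.
    by apply/funext => k; apply/propext; split=> // -[/(nested_lt nE)]; lia.
  have -> : ldeg E i (i + 1) = 0.
    rewrite /ldeg /card [X in fset_set X](_ : _ = set0) ?fset_set0 //.
    by apply/funext => k; apply/propext; split=> // -[/(nested_lt nE)]; lia.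
  by rewrite addrK !mul0r !addr0.
have [k [ik kj edge_ik edge_kj]] := nested_apex nE Eij.
have [F1 F2] : f (i + 1) = f k + rdeg E i k * f i /\ f (k - 1) = f i + ldeg E i k * f k.
  by apply: IH => [|//|l il lk]; [lia | apply: a_deg; lia].
have [F3 F4] : f (k + 1) = f j + rdeg E k j * f k /\ f (j - 1) = f k + ldeg E k j * f j.
  by apply: IH => [|//|l il lk]; [lia | apply: a_deg; lia].
(* All arcs at the apex [k] stay under the arc from [i] to [j], by non-crossing. *)
have a_k : a k = 1 + rdeg E k j + ldeg E i k.
  rewrite a_deg //; congr (_ + _ + _); apply: eq_card => l /=.
    split=> [Ekl|[]//]; split=> //; rewrite leNgt; apply/negP => jl.
    exact: (nested_nc nE Eij Ekl ik kj jl).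
  split=> [Elk|[]//]; split=> //; rewrite leNgt; apply/negP => li.
  exact: (nested_nc nE Elk Eij li ik kj).
(* The additional arc is the one from [i] to [j]; any other one ending beyond [k] would cross the
   edge from [k] to [j]. *)
have r_ij : rdeg E i j = rdeg E i k + 1.
  rewrite -[1](@card_pred1 _ j (fun l => l = j)) //; apply: card_split.
  - by apply: sub_finite_set (nested_finr i nE) => l [].
  - move=> l /=; split=> [[Eil lj]|[[Eil lk]|->]] //; last by split=> //; lia.
    have [->|l_j] := eqVneq l j; [by right | left; split=> //].
    rewrite leNgt; apply/negP => kl; case: edge_kj => [Ekj|]; last by lia.
    by apply: (nested_nc nE Eil Ekj ik kl); lia.
  - by move=> l /= [_ lk] lj; lia.
have l_ij : ldeg E i j = ldeg E k j + 1.
  rewrite -[1](@card_pred1 _ i (fun l => l = i)) //; apply: card_split.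
  - by apply: sub_finite_set (nested_finl j nE) => l [].
  - move=> l /=; split=> [[Elj il]|[[Elj kl]|->]] //; last by split=> //; lia.
    have [->|l_i] := eqVneq l i; [by right | left; split=> //].
    rewrite leNgt; apply/negP => lk; case: edge_ik => [Eik|]; last by lia.
    by apply: (nested_nc nE Eik Elj _ lk kj); lia.
  - by move=> l /= [_ lk] lj; lia.
have fk := fS k; rewrite a_k F2 F3 in fk.
by rewrite r_ij l_ij F1 F4; split; lra.
Qed.

(** * Transport across the bridging arcs *)

(** [B x y] stands for a bridging arc from outer [x] to inner [y]; [sys_step] is the triangle on its
    right, whose third vertex lies on either boundary. *)
Record strip_system (n m : nat) (E E' B : int -> int -> Prop) : Prop := StripSystem {
  sys_outer : nested n E;
  sys_inner : nested m E';
  sys_EB : forall i j x y, E i j -> B x y -> i < x -> x < j -> False;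
  sys_E'B : forall i j x y, E' i j -> B x y -> i < y -> y < j -> False;
  sys_BB : forall x y p q, B x y -> B p q -> x < p -> q < y -> False;
  sys_Bper : forall x y, B (x + n%:Z) (y + m%:Z) <-> B x y;
  sys_step : forall x y, B x y ->
    (exists x', edge E x x' /\ B x' y) \/ (exists y', edge E' y y' /\ B x y')
}.

(** The notion is symmetric in the two boundaries, so each later argument is made for one of them
    only. *)
Lemma strip_system_swap n m E E' B :
  strip_system n m E E' B -> strip_system m n E' E (fun y x => B x y).
Proof.
case=> nE nE' EB E'B BB Bper step; split=> //.
- by move=> i j y x; apply: E'B.
- by move=> i j y x; apply: EB.
- by move=> y x q p Bxy Bpq yq px; exact: (BB _ _ _ _ Bpq Bxy px yq).
- by move=> y x /step[]; [right | left].
Qed.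

Lemma edge_crossF n m E E' B i j x y : strip_system n m E E' B ->
  edge E i j -> B x y -> i < x -> x < j -> False.
Proof. by move=> S [Eij|->]; [apply: (sys_EB S) | lia]. Qed.

(** If the inner ends of two bridging arcs at [x] are more than [m] apart, one of the arcs crosses
    the translate of the other. *)
Lemma bridging_fin n m E E' B x : (0 < n)%N -> strip_system n m E E' B ->
  finite_set [set y | B x y].
Proof.
move=> n0 S; have [[y0 /= B0]|no] := pselect (exists y, B x y); last first.
  by rewrite [X in finite_set X](_ : _ = set0) //; apply/funext => y; apply/propext;
     split=> // ?; apply: no; exists y.
apply: (@finite_int_interval _ (y0 - m%:Z) (y0 + m%:Z)) => y /= By.
have B0' := (sys_Bper S _ _).2 B0; have By' := (sys_Bper S _ _).2 By.
split; rewrite leNgt; apply/negP => lt.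
  by apply: (sys_BB S B0 By'); lia.
by apply: (sys_BB S By B0'); lia.
Qed.

(* Number of ends of arcs met when turning around x from the boundary on its  *)
(* right up to the bridging arc (x, y), included.                             *)
Definition fan (E B : int -> int -> Prop) (x y : int) : int :=
  card [set k | E x k] + card [set l | B x l /\ y <= l].

(* f and g are one coordinate of vectors attached to the outer and inner      *)
(* marked points such that the two ends of every edge have determinant 1; each *)
(* triangle crossed when turning around x then adds a multiple of f x.        *)
Definition compatible (E E' B : int -> int -> Prop) (f g : int -> int) (x y : int) : Prop :=
  g y = f (x + 1) - fan E B x y * f x /\
  f x = g (y + 1) - fan E' (fun y x => B x y) y x * g y.

(** The quiddity entry at [x]. A loop has two lifts at [x] and is counted once on each side. *)
Definition strip_degree (E B : int -> int -> Prop) (x : int) : int :=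
  1 + card [set k | E x k] + card [set k | E k x] + card [set l | B x l].

Lemma strip_degree_under n m E E' B i j k : strip_system n m E E' B ->
  edge E i j -> i < k -> k < j ->
  strip_degree E B k = 1 + card [set l | E k l] + card [set l | E l k].
Proof.
move=> S edge_ij ik kj; rewrite /strip_degree [X in _ + X](_ : _ = 0) ?addr0 //.
rewrite /card [X in fset_set X](_ : _ = set0) ?fset_set0 //.
by apply/funext => y; apply/propext; split=> // Bky; apply: (edge_crossF S edge_ij Bky ik kj).
Qed.

Lemma fan_per n m E E' B x y : (0 < n)%N -> strip_system n m E E' B ->
  fan E B (x + n%:Z) (y + m%:Z) = fan E B x y.
Proof.
move=> n0 S; congr (_ + _).
  apply: (@card_shift n%:Z); first exact: nested_finr (sys_outer S).
  by move=> k; apply: nested_per (sys_outer S) _ _.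
apply: (@card_shift m%:Z); first by apply: sub_finite_set (bridging_fin x n0 S) => l [].
by move=> l /=; rewrite lerD2r; split=> -[Bl yl]; split=> //; apply/(sys_Bper S).
Qed.

Lemma strip_degree_per n m E E' B x : (0 < n)%N -> strip_system n m E E' B ->
  strip_degree E B (x + n%:Z) = strip_degree E B x.
Proof.
move=> n0 S; congr (_ + _ + _ + _).
- apply: (@card_shift n%:Z); first exact: nested_finr (sys_outer S).
  by move=> k; apply: nested_per (sys_outer S) _ _.
- apply: (@card_shift n%:Z); first exact: nested_finl (sys_outer S).
  by move=> k; apply: nested_per (sys_outer S) _ _.
- apply: (@card_shift m%:Z); first exact: bridging_fin n0 S.
  by move=> l; apply: sys_Bper S _ _.
Qed.

(** By [polygon], the first relation at [(x, y)] reads [f x' = f x + g y]; the recurrence at [x']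
    turns this into the first relation at [(x', y)]. For the second relation, the fan of [y] loses
    exactly the arc to [x]. *)
Lemma compatible_step n m E E' B f g x y x' : (0 < n)%N -> (0 < m)%N ->
  strip_system n m E E' B -> solution (strip_degree E B) f ->
  edge E x x' -> B x y -> B x' y ->
  compatible E E' B f g x y -> compatible E E' B f g x' y.
Proof.
move=> n0 m0 S fS edge_xx' Bxy Bx'y [C1 C2].
have xx' := edge_lt (sys_outer S) edge_xx'.
have [P1 P2] := polygon (sys_outer S) fS edge_xx'
  (fun k xk kx' => strip_degree_under S edge_xx' xk kx').
(* Any further arc in the fan would cross [(x', y)]; the [1] is [(x, y)] itself. *)
have fan_xy : fan E B x y = rdeg E x x' + 1.
  congr (_ + _).
    apply: eq_card => k /=; split=> [Exk|[]//]; split=> //; rewrite leNgt; apply/negP => lt.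
    exact: (sys_EB S Exk Bx'y).
  apply: (@card_pred1 _ y) => l /=; split=> [[Bxl yl]|->//].
  apply/eqP; rewrite eq_le yl andbT leNgt; apply/negP => lt.
  exact: (sys_BB S Bxl Bx'y).
have deg_x' : strip_degree E B x' = 1 + fan E B x' y + ldeg E x x'.
  rewrite /strip_degree /fan addrAC !addrA; congr (_ + _ + _ + _); last first.
    apply: eq_card => k /=; split=> [Ekx'|[]//]; split=> //; rewrite leNgt; apply/negP => lt.
    exact: (sys_EB S Ekx' Bxy).
  apply: eq_card => l /=; split=> [Bxl|[]//]; split=> //; rewrite leNgt; apply/negP => lt.
  exact: (sys_BB S Bxy Bxl).
have fan_yx : fan E' (fun y x => B x y) y x = fan E' (fun y x => B x y) y x' + 1.
  rewrite /fan -addrA; congr (_ + _).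
  rewrite -[1](@card_pred1 _ x (fun k => k = x)) //; apply: card_split.
  - by apply: sub_finite_set (bridging_fin y m0 (strip_system_swap S)) => k [].
  - move=> k /=; split=> [[Bky xk]|[[Bky lt]|->]] //; last by split=> //; lia.
    have [->|k_x] := eqVneq k x; [by right | left; split=> //].
    rewrite leNgt; apply/negP => kx'.
    by apply: (edge_crossF S edge_xx' Bky) => //; lia.
  - by move=> k /= [_ lt] ?; lia.
have fx' := fS x'; rewrite deg_x' P2 in fx'.
rewrite fan_xy P1 in C1; rewrite fan_yx in C2.
by split; lra.
Qed.

Lemma compatible_swap E E' B f g x y : compatible E E' B f g x y <->
  compatible E' E (fun y x => B x y) g f y x.
Proof. by split=> -[]. Qed.

(** Follow the triangles from left to right. A step cannot jump past [(X, Y)], since that arc would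
    then cross a side of the triangle. *)
Lemma compatible_chain n m E E' B f g x y X Y : (0 < n)%N -> (0 < m)%N ->
  strip_system n m E E' B ->
  solution (strip_degree E B) f -> solution (strip_degree E' (fun y x => B x y)) g ->
  B x y -> B X Y -> x <= X -> y <= Y ->
  compatible E E' B f g x y -> compatible E E' B f g X Y.
Proof.
move=> n0 m0 S fS gS Bxy BXY.
have [p] := ubnP `|((X - x) + (Y - y))%R|%N; elim: p x y Bxy => // p IH x y Bxy.
rewrite ltnS => le_p xX yY C.
have [[<- <-]//|neq] := pselect (x = X /\ y = Y).
case: (sys_step S Bxy) => -[z [edge_z Bz]].
  have lt := edge_lt (sys_outer S) edge_z.
  have zX : z <= X.
    rewrite leNgt; apply/negP => Xz; have [xX'|Xx] := ltrP x X.
      exact: (edge_crossF S edge_z BXY).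
    by apply: (sys_BB S BXY Bz Xz); lia.
  apply: (IH z y) => //; first by lia.
  exact: (compatible_step n0 m0 S fS edge_z Bxy Bz C).
have lt := edge_lt (sys_inner S) edge_z.
have zY : z <= Y.
  rewrite leNgt; apply/negP => Yz; have [yY'|Yy] := ltrP y Y.
    exact: (edge_crossF (strip_system_swap S) edge_z BXY).
  by apply: (sys_BB S Bz BXY) => //; lia.
apply: (IH x z) => //; first by lia.
apply/compatible_swap; move/compatible_swap: C.
exact: (compatible_step m0 n0 (strip_system_swap S) gS edge_z Bxy Bz).
Qed.

Lemma strip_system_trace n m E E' B (x y : int) (F F' : int -> int -> int) :
  (0 < n)%N -> (0 < m)%N -> strip_system n m E E' B -> B x y ->
  infinite_frieze F -> (forall i, F i i = strip_degree E B i) ->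
  infinite_frieze F' -> (forall i, F' i i = strip_degree E' (fun y x => B x y) i) ->
  F 1 n%:Z - F 2 (n%:Z - 1) = F' 1 m%:Z - F' 2 (m%:Z - 1).
Proof.
move=> n0 m0 S Bxy Ffr Fdeg F'fr F'deg.
have per i := strip_degree_per i n0 S.
have per' i := strip_degree_per i m0 (strip_system_swap S).
(* These values force [g (y + m) = 1], so the inner trace can be read off, and [f (x + 2n) = - f x],
   which cancels the fan terms. *)
have [f [fS fxn fxn1]] := solution_exists (strip_degree E B) (x + n%:Z) 0 1.
(* The initial values of [g] solve the two relations of [compatible] at [(x, y)]. *)
have [g [gS gy gy1]] := solution_exists (strip_degree E' (fun y x => B x y)) y
  (f (x + 1) - fan E B x y * f x)
  (f x + fan E' (fun y x => B x y) y x * (f (x + 1) - fan E B x y * f x)).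
have C0 : compatible E E' B f g x y by split; rewrite gy ?gy1 ?addrK.
have Bn := (sys_Bper S _ _).2 Bxy; have Bnn := (sys_Bper S _ _).2 Bn.
have C1 : compatible E E' B f g (x + n%:Z) (y + m%:Z).
  by apply: (compatible_chain n0 m0 S fS gS Bxy Bn _ _ C0); lia.
have C2 : compatible E E' B f g (x + n%:Z + n%:Z) (y + m%:Z + m%:Z).
  by apply: (compatible_chain n0 m0 S fS gS Bn Bnn _ _ C1); lia.
have [G0 _] := C0; have [G1 _] := C1; have [G2 _] := C2.
rewrite !(fan_per _ _ n0 S) in G1 G2.
have T0 := solution_trace n0 Ffr Fdeg per fS x.
have T1 := solution_trace n0 Ffr Fdeg per fS (x + 1).
have T' := solution_trace m0 F'fr F'deg per' gS y.
rewrite !(addrAC x 1) in T1; rewrite fxn1 fxn mulr0 subr0 in G1.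
rewrite G1 mulr1 in T'; rewrite fxn mulr0 in T0; rewrite [x + n%:Z + 1 + _]addrAC fxn1 mulr1 in T1.
rewrite -T1 -T' G2 G0.
have -> : f (x + n%:Z + n%:Z) = - f x by lra.
ring.
Qed.

(** * Triangles given by maximality *)

(* Outer arcs E, inner arcs E' (read from left to right) and bridging arcs B  *)
(* of a triangulation; max_E, max_E' and max_B express maximality.            *)
Record maximal_system (n m : nat) (E E' B : int -> int -> Prop) : Prop := MaximalSystem {
  max_lt : forall i j, E i j -> i + 1 < j;
  max_lt' : forall i j, E' i j -> i + 1 < j;
  max_le : forall i j, E i j -> j <= i + n%:Z;
  max_le' : forall i j, E' i j -> j <= i + m%:Z;
  max_per : forall i j, E (i + n%:Z) (j + n%:Z) <-> E i j;
  max_per' : forall i j, E' (i + m%:Z) (j + m%:Z) <-> E' i j;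
  max_perB : forall x y, B (x + n%:Z) (y + m%:Z) <-> B x y;
  max_nc : forall i j p q, E i j -> E p q -> i < p -> p < j -> j < q -> False;
  max_nc' : forall i j p q, E' i j -> E' p q -> i < p -> p < j -> j < q -> False;
  max_EB : forall i j x y, E i j -> B x y -> i < x -> x < j -> False;
  max_E'B : forall i j x y, E' i j -> B x y -> i < y -> y < j -> False;
  max_BB : forall x y p q, B x y -> B p q -> x < p -> q < y -> False;
  max_E : forall i j, i + 1 < j -> j <= i + n%:Z ->
    (forall p q, E p q -> i < p -> p < j -> j < q -> False) ->
    (forall p q, E p q -> p < i -> i < q -> q < j -> False) ->
    (forall x y, B x y -> i < x -> x < j -> False) -> E i j;
  max_E' : forall i j, i + 1 < j -> j <= i + m%:Z ->
    (forall p q, E' p q -> i < p -> p < j -> j < q -> False) ->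
    (forall p q, E' p q -> p < i -> i < q -> q < j -> False) ->
    (forall x y, B x y -> i < y -> y < j -> False) -> E' i j;
  max_B : forall x y,
    (forall p q, E p q -> p < x -> x < q -> False) ->
    (forall p q, E' p q -> p < y -> y < q -> False) ->
    (forall p q, B p q -> p < x -> y < q -> False) ->
    (forall p q, B p q -> x < p -> q < y -> False) -> B x y
}.

Lemma maximal_system_swap n m E E' B :
  maximal_system n m E E' B -> maximal_system m n E' E (fun y x => B x y).
Proof.
case=> lt lt' le le' per per' perB nc nc' EB E'B BB mE mE' mB; split=> //.
- by move=> i j y x; apply: E'B.
- by move=> i j y x; apply: EB.
- by move=> y x q p Bxy Bpq yq px; exact: (BB _ _ _ _ Bpq Bxy px yq).
- by move=> i j ij le_ij h1 h2 h3; apply: mE' => // x y /h3.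
- by move=> i j ij le_ij h1 h2 h3; apply: mE => // x y /h3.
- by move=> y x h1 h2 h3 h4; apply: mB => // p q Bpq ? ?; [apply: h4 Bpq _ _ | apply: h3 Bpq _ _].
Qed.

Lemma ex_max_int (P : int -> Prop) (u i : int) : P i -> (forall k, P k -> k <= u) ->
  exists k, P k /\ forall l, P l -> l <= k.
Proof.
have [p] := ubnP `|u - i|%N; elim: p i => // p IH i; rewrite ltnS => le_p Pi Pu.
have [[l [Pl il]]|no] := pselect (exists l, P l /\ i < l).
  by apply: (IH l) => //; have := Pu l Pl; lia.
by exists i; split=> // l Pl; rewrite leNgt; apply/negP => il; apply: no; exists l.
Qed.

(** The apex under an arc from [i] to [j] is the farthest neighbour [k] of [i] before [j]: nothing
    crosses the chord from [k] to [j], so it is a boundary segment or, by maximality, an arc. *)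
Lemma maximal_nested n m E E' B : maximal_system n m E E' B -> nested n E.
Proof.
move=> S; split; [exact: max_lt S|exact: max_le S|exact: max_per S|exact: max_nc S|].
move=> i j Eij; have lt_ij := max_lt S Eij; have le_ij := max_le S Eij.
have [k [[kj edge_ik] k_max]] := @ex_max_int (fun k => k < j /\ edge E i k) j (i + 1)
  (conj lt_ij (or_intror erefl)) (fun k h => ltW h.1).
have ik : i < k by case: edge_ik => [/(max_lt S)|]; lia.
exists k; split=> //; have [->|k1_j] := eqVneq j (k + 1); [by right | left].
apply: (max_E S); try lia.
- by move=> p q Epq kp pj jq; apply: (max_nc S Eij Epq); lia.
- move=> p q Epq pk kq qj; have [pi|ip|pi] := ltrgtP p i.
  + by apply: (max_nc S Epq Eij); lia.
  + case: edge_ik => [Eik|]; last by lia.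
    exact: (max_nc S Eik Epq).
  + by rewrite pi in Epq; have := k_max q (conj qj (or_introl Epq)); lia.
- by move=> x y Bxy kx xj; apply: (max_EB S Eij Bxy); lia.
Qed.

(** Let [x'], [y'] be the farthest neighbours to the right of [x], [y]. Only some [(x, q)] with
    [y < q] can block [(x', y)], and only some [(p, y)] with [x < p] can block [(x, y')]. These two
    blockers cross, so one of the candidates is present. *)
Lemma maximal_step n m E E' B x y : maximal_system n m E E' B -> (0 < n)%N -> (0 < m)%N ->
  B x y -> (exists x', edge E x x' /\ B x' y) \/ (exists y', edge E' y y' /\ B x y').
Proof.
move=> S n0 m0 Bxy.
have [x' [edge_x x'_max]] : exists x', edge E x x' /\ forall l, edge E x l -> l <= x'.
  by apply: (@ex_max_int _ (x + n%:Z) (x + 1)); [right | move=> k [/(max_le S)|]; lia].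
have [y' [edge_y y'_max]] : exists y', edge E' y y' /\ forall l, edge E' y l -> l <= y'.
  by apply: (@ex_max_int _ (y + m%:Z) (y + 1)); [right | move=> k [/(max_le' S)|]; lia].
have xx' : x < x' by case: edge_x => [/(max_lt S)|]; lia.
have yy' : y < y' by case: edge_y => [/(max_lt' S)|]; lia.
have [Bx'y|nBx'y] := pselect (B x' y); first by left; exists x'.
have [Bxy'|nBxy'] := pselect (B x y'); first by right; exists y'.
have E_x' p q : E p q -> p < x' -> x' < q -> False.
  move=> Epq px' x'q; have [px|xp|px] := ltrgtP p x.
  + by apply: (max_EB S Epq Bxy); lia.
  + by case: edge_x => [Ex|]; [apply: (max_nc S Ex Epq) | lia].
  + by rewrite px in Epq; have := x'_max q (or_introl Epq); lia.
have E_y' p q : E' p q -> p < y' -> y' < q -> False.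
  move=> Epq py' y'q; have [py|yp|py] := ltrgtP p y.
  + by apply: (max_E'B S Epq Bxy); lia.
  + by case: edge_y => [Ey|]; [apply: (max_nc' S Ey Epq) | lia].
  + by rewrite py in Epq; have := y'_max q (or_introl Epq); lia.
have [q [Bxq yq]] : exists q, B x q /\ y < q.
  apply: contrapT => no; apply: nBx'y; apply: (max_B S) => //.
  - by move=> p q Epq py yq; apply: (max_E'B S Epq Bxy).
  - move=> p q Bpq px' yq; have [px|xp|px] := ltrgtP p x.
    + exact: (max_BB S Bpq Bxy).
    + by case: edge_x => [Ex|]; [apply: (max_EB S Ex Bpq) | lia].
    + by apply: no; exists q; rewrite -px.
  - by move=> p q Bpq x'p qy; apply: (max_BB S Bxy Bpq) => //; lia.
have [p [Bpy xp]] : exists p, B p y /\ x < p.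
  apply: contrapT => no; apply: nBxy'; apply: (max_B S) => //.
  - by move=> p r Epr px xr; apply: (max_EB S Epr Bxy).
  - by move=> p r Bpr px y'r; apply: (max_BB S Bpr Bxy) => //; lia.
  - move=> p r Bpr xp ry'; have [ry|yr|ry] := ltrgtP r y.
    + exact: (max_BB S Bxy Bpr).
    + by case: edge_y => [Ey|]; [apply: (max_E'B S Ey Bpr) | lia].
    + by apply: no; exists p; rewrite -ry.
by case: (max_BB S Bxq Bpy xp yq).
Qed.

Lemma maximal_strip n m E E' B : maximal_system n m E E' B -> (0 < n)%N -> (0 < m)%N ->
  strip_system n m E E' B.
Proof.
move=> S n0 m0; split.
- exact: maximal_nested S.
- exact: maximal_nested (maximal_system_swap S).
- exact: max_EB S.
- exact: max_E'B S.
- exact: max_BB S.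
- exact: max_perB S.
- by move=> x y; apply: maximal_step S n0 m0.
Qed.

(* Witness: the left end of a longest edge. *)
Lemma exposed_point n m E E' B : maximal_system n m E E' B -> (0 < n)%N ->
  exists x, forall p q, E p q -> p < x -> x < q -> False.
Proof.
move=> S n0.
have [d [[x edge_x] d_max]] : exists d, (exists x, edge E x (x + d)) /\
    forall l, (exists x, edge E x (x + l)) -> l <= d.
  apply: (@ex_max_int _ n%:Z 1); first by exists 0; right.
  by move=> k [x [/(max_le S)|]]; lia.
exists x => p q Epq px xq; have := max_lt S Epq.
have := d_max (q - p) (ex_intro _ p _); rewrite addrC subrK => /(_ (or_introl Epq)) le_d.
case: edge_x => [Ex|]; last by lia.
by move=> _; apply: (max_nc S Epq Ex) => //; lia.
Qed.

(** Without bridging arcs, one joining exposed points of the two boundaries would cross nothing,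
    against maximality. *)
Lemma maximal_bridge n m E E' B : maximal_system n m E E' B -> (0 < n)%N -> (0 < m)%N ->
  exists x y, B x y.
Proof.
move=> S n0 m0; apply: contrapT => no.
have [x x_exp] := exposed_point S n0.
have [y y_exp] := exposed_point (maximal_system_swap S) m0.
have noB p q : ~ B p q by move=> Bpq; apply: no; exists p, q.
by apply: no; exists x, y; apply: (max_B S) => // p q /noB.
Qed.

(** * From arcs of the annulus to integers *)

Lemma before_deck n m z p q :
  before (deck_point n m z p) (deck_point n m z q) = before p q.
Proof. by case: p q => [i|i] [j|j] //=; lia. Qed.

Lemma cross_deck n m z a b : cross (deck n m z a) (deck n m z b) = cross a b.
Proof. by rewrite /cross /= !before_deck. Qed.

Lemma deck_add n m z w a : deck n m z (deck n m w a) = deck n m (w + z) a.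
Proof.
by case: a => -[i|i] [j|j]; rewrite /deck /= /Outer /Inner !mulrDl !addrA.
Qed.

Lemma deck0 n m a : deck n m 0 a = a.
Proof. by case: a => -[i|i] [j|j]; rewrite /deck /= /Outer /Inner !mul0r !addr0. Qed.

Lemma cross_sym a b : cross a b = cross b a.
Proof. by rewrite /cross orbC. Qed.

Lemma boundary_segment_deck n m z a : boundary_segment a -> boundary_segment (deck n m z a).
Proof.
case=> i [->|->]; rewrite /deck /=.
  by exists (i + z * n%:Z); left; rewrite addrAC.
by exists (i + z * m%:Z); right; rewrite addrAC.
Qed.

Lemma annulus_arc_deck n m z a : annulus_arc n m a -> annulus_arc n m (deck n m z a).
Proof.
case=> bef nseg ncr; split; first by rewrite before_deck.
  move=> /(@boundary_segment_deck n m (- z)); rewrite deck_add addrN deck0.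
  exact: nseg.
case=> w; rewrite deck_add addrC -deck_add cross_deck => cr.
by apply: ncr; exists w.
Qed.

(** Collections are closed under deck transformations, so the whole orbit of [a] is adjoined to [T];
    invariance of [T] reduces the crossing check to the single lift [a]. *)
Lemma maximal_arc n m T a : triangulation n m T -> annulus_arc n m a ->
  (forall t, T t -> cross a t -> False) -> T a.
Proof.
move=> [[Tarc Tdeck Tnc] Tmax] arc_a nc_a.
pose T' : set strip_arc := [set t | T t \/ exists z, t = deck n m z a].
have T'_def : T' = T.
  apply: Tmax => [|t Tt]; last by left.
  have ncT z t w : T t -> cross (deck n m z a) (deck n m w t) -> False.
    rewrite (_ : deck n m w t = deck n m z (deck n m (w - z) t)); last by rewrite deck_add subrK.
    by rewrite cross_deck => Tt; apply: nc_a; apply: Tdeck.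
  split.
  - by move=> t [/Tarc//|[z ->]]; apply: annulus_arc_deck.
  - move=> t z [Tt|[w ->]]; first by left; apply: Tdeck.
    by right; exists (w + z); rewrite deck_add.
  - move=> t u [Tt|[z ->]] [Tu|[w ->]] [v].
    + by move=> cr; apply: (Tnc t u Tt Tu); exists v.
    + rewrite deck_add cross_sym -[X in cross _ X](deck0 n m); exact: ncT.
    + exact: ncT.
    + rewrite deck_add -(subrK z (w + v)) -deck_add cross_deck => cr.
      by case: arc_a => _ _; apply; exists (w + v - z).
by rewrite -T'_def; right; exists 0; rewrite deck0.
Qed.

Definition outer_arc (T : set strip_arc) (i j : int) : Prop := T (Outer i, Outer j).
(** The ends are exchanged because [before] runs along the inner line from right to left. *)
Definition inner_arc (T : set strip_arc) (i j : int) : Prop := T (Inner j, Inner i).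
Definition bridge (T : set strip_arc) (x y : int) : Prop := T (Outer x, Inner y).

Lemma mulz_lt (z : int) (n : nat) : 0 < z * n%:Z -> n%:Z <= z * n%:Z.
Proof.
have [z0|z0] := lerP z 0; first by rewrite ltNge mulr_le0_ge0.
by move=> _; rewrite ler_peMl //; lia.
Qed.

Lemma triangulation_maximal n m T : (0 < n)%N -> (0 < m)%N -> triangulation n m T ->
  maximal_system n m (outer_arc T) (inner_arc T) (bridge T).
Proof.
move=> n0 m0 triT; have [[Tarc Tdeck Tnc] _] := triT.
have Tper a : T (deck n m 1 a) <-> T a.
  split=> [/(Tdeck _ (-1))|/(Tdeck _ 1)//].
  by rewrite deck_add addrN deck0.
have nocross a b : T a -> T b -> cross a b -> False.
  by move=> Ta Tb; rewrite -[b](deck0 n m) => cr; apply: (Tnc _ _ Ta Tb); exists 0.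
split.
- move=> i j Tij; have [/= lt nseg _] := Tarc _ Tij.
  suff : j <> i + 1 by lia.
  by move=> ji; apply: nseg; exists i; left; rewrite ji.
- move=> i j Tij; have [/= lt nseg _] := Tarc _ Tij.
  suff : j <> i + 1 by lia.
  by move=> ji; apply: nseg; exists i; right; rewrite ji.
- move=> i j Tij; have [/= lt _ ncr] := Tarc _ Tij.
  rewrite leNgt; apply/negP => gt; apply: ncr; exists 1.
  (* If [i + n < j], the endpoints alternate as [i < i + n < j < j + n]. *)
  by rewrite /cross /= !mul1r; lia.
- move=> i j Tij; have [/= lt _ ncr] := Tarc _ Tij.
  rewrite leNgt; apply/negP => gt; apply: ncr; exists 1.
  by rewrite /cross /= !mul1r; lia.
- by move=> i j; rewrite /outer_arc -(Tper (Outer i, Outer j)) /deck /= !mul1r.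
- by move=> i j; rewrite /inner_arc -(Tper (Inner j, Inner i)) /deck /= !mul1r.
- by move=> i j; rewrite /bridge -(Tper (Outer i, Inner j)) /deck /= !mul1r.
- by move=> i j p q Tij Tpq ip pj jq; apply: (nocross _ _ Tij Tpq); rewrite /cross /=; lia.
- by move=> i j p q Tij Tpq ip pj jq; apply: (nocross _ _ Tij Tpq); rewrite /cross /=; lia.
- by move=> i j x y Tij Txy ix xj; apply: (nocross _ _ Tij Txy); rewrite /cross /=; lia.
- by move=> i j x y Tij Txy iy yj; apply: (nocross _ _ Tij Txy); rewrite /cross /=; lia.
- by move=> x y p q Txy Tpq xp qy; apply: (nocross _ _ Txy Tpq); rewrite /cross /=; lia.
- move=> i j ij le_ij h1 h2 h3; apply: (maximal_arc triT).
    split=> /=; first by lia.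
      by case=> k [] // [ik jk]; lia.
    case=> z; rewrite /cross /= => cr.
    have := @mulz_lt z n; have := @mulz_lt (- z) n; rewrite mulNr; lia.
  case=> -[p|p] [q|q] Tpq; have [/= bef _ _] := Tarc _ Tpq => //; rewrite /cross /=.
  + case/orP=> /and3P[]; [exact: h1 Tpq | exact: h2 Tpq].
  + by rewrite !(andbT, andbF) orbF => /andP[]; apply: h3 Tpq.
- move=> i j ij le_ij h1 h2 h3; apply: (maximal_arc triT).
    split=> /=; first by lia.
      by case=> k [] // [ik jk]; lia.
    case=> z; rewrite /cross /= => cr.
    have := @mulz_lt z m; have := @mulz_lt (- z) m; rewrite mulNr; lia.
  case=> -[p|p] [q|q] Tpq; have [/= bef _ _] := Tarc _ Tpq => //; rewrite /cross /=.
  + by move=> /andP[qj iq]; apply: (h3 _ _ Tpq).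
  + by case/orP=> /and3P[a b c]; [apply: (h2 _ _ Tpq) | apply: (h1 _ _ Tpq)].
- move=> x y h1 h2 h3 h4; apply: (maximal_arc triT).
    split=> //=; first by case=> k [].
    (* A deck transformation moves both ends in the same direction, while a crossing needs opposite
       ones. *)
    case=> z; rewrite /cross /= => cr; nia.
  case=> -[p|p] [q|q] Tpq; have [/= bef _ _] := Tarc _ Tpq => //; rewrite /cross /=.
  + by rewrite !(andbT, andbF) /= => /andP[a b]; apply: (h1 _ _ Tpq).
  + move=> /orP[] /andP[a b]; [apply: (h4 _ _ Tpq) | apply: (h3 _ _ Tpq)] => //.
  + by rewrite orbF => /andP[a b]; apply: (h2 _ _ Tpq).
Qed.

(** * Quiddity sequences *)

Lemma card_split3 (K : choiceType) (D A B C : set K) :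
  finite_set A -> finite_set B -> finite_set C ->
  (forall x, D x <-> [\/ A x, B x | C x]) ->
  (forall x, A x -> B x -> False) -> (forall x, A x -> C x -> False) ->
  (forall x, B x -> C x -> False) -> card D = card A + card B + card C.
Proof.
move=> Af Bf Cf DABC AB AC BC.
rewrite -addrA -(@card_split _ (B `|` C) B C) ?finite_setU //.
apply: card_split.
- apply: (@sub_finite_set _ _ (A `|` (B `|` C))); last by rewrite !finite_setU.
  by move=> x /DABC [? | ? | ?]; [left | right; left | right; right].
- by move=> x; rewrite DABC; split=> [[]|[|[]]]; do ?[by left | by right | by right; left | by right; right
   | by apply: Or31 | by apply: Or32 | by apply: Or33].
- by move=> x Ax [Bx|Cx]; [apply: AB Ax Bx | apply: AC Ax Cx].
Qed.

(** The arcs at a lift fall into three disjoint kinds, going right, going left and bridging, which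
    are injective images of the sets counted by [strip_degree]. *)
Lemma triangles_at_outer n m T x : (0 < n)%N -> (0 < m)%N -> triangulation n m T ->
  (triangles_at T (Outer x))%:Z = strip_degree (outer_arc T) (bridge T) x.
Proof.
move=> n0 m0 triT; have [[Tarc _ _] _] := triT.
have M := triangulation_maximal n0 m0 triT.
have S := maximal_strip M n0 m0.
have fr := nested_finr x (sys_outer S); have fl := nested_finl x (sys_outer S).
have fb := bridging_fin x n0 S.
pose hr k : strip_arc := (Outer x, Outer k).
pose hl k : strip_arc := (Outer k, Outer x).
pose hb k : strip_arc := (Outer x, Inner k).
rewrite /strip_degree -(card_image (h := hr) _ fr); last by move=> ? ? [].
rewrite -(card_image (h := hl) _ fl); last by move=> ? ? [].
rewrite -(card_image (h := hb) _ fb); last by move=> ? ? [].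
rewrite /triangles_at -addn1 PoszD addrC -!addrA; congr (_ + _); rewrite !addrA.
apply: (card_split3 (finite_image hr fr) (finite_image hl fl) (finite_image hb fb)).
- case=> -[p|p] [q|q]; split.
  + case=> Tpq [[px]|[qx]].
      by apply: Or31; exists q; rewrite /= /outer_arc /hr -px.
    by apply: Or32; exists p; rewrite /= /outer_arc /hl -qx.
  + by case=> -[k Tk []] // <- <-; split=> //; [left|right].
  + case=> Tpq [[px]|//].
    by apply: Or33; exists q; rewrite /= /bridge /hb -px.
  + by case=> -[k Tk []] // <- <-; split=> //; left.
  + by case=> /Tarc[].
  + by case=> -[k Tk []].
  + by case=> Tpq [].
  + by case=> -[k Tk []].
- move=> a [k /(max_lt M) xk <-] [l Tl [_ kx]].
  by rewrite kx in xk; lia.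
- by move=> a [k _ <-] [l _ []].
- by move=> a [k _ <-] [l _ []].
Qed.

Lemma triangles_at_inner n m T y : (0 < n)%N -> (0 < m)%N -> triangulation n m T ->
  (triangles_at T (Inner y))%:Z = strip_degree (inner_arc T) (fun y x => bridge T x y) y.
Proof.
move=> n0 m0 triT; have [[Tarc _ _] _] := triT.
have M := triangulation_maximal n0 m0 triT.
have S := strip_system_swap (maximal_strip M n0 m0).
have fr := nested_finr y (sys_outer S); have fl := nested_finl y (sys_outer S).
have fb := bridging_fin y m0 S.
pose hr k : strip_arc := (Inner k, Inner y).
pose hl k : strip_arc := (Inner y, Inner k).
pose hb k : strip_arc := (Outer k, Inner y).
rewrite /strip_degree -(card_image (h := hr) _ fr); last by move=> ? ? [].
rewrite -(card_image (h := hl) _ fl); last by move=> ? ? [].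
rewrite -(card_image (h := hb) _ fb); last by move=> ? ? [].
rewrite /triangles_at -addn1 PoszD addrC -!addrA; congr (_ + _); rewrite !addrA.
apply: (card_split3 (finite_image hr fr) (finite_image hl fl) (finite_image hb fb)).
- case=> -[p|p] [q|q]; split.
  + by case=> Tpq [].
  + by case=> -[k Tk []].
  + case=> Tpq [//|[qy]].
    by apply: Or33; exists p; rewrite /= /bridge /hb -qy.
  + by case=> -[k Tk []] // <- <-; split=> //; right.
  + by case=> /Tarc[].
  + by case=> -[k Tk []].
  + case=> Tpq [[py]|[qy]].
      by apply: Or32; exists q; rewrite /= /inner_arc /hl -py.
    by apply: Or31; exists p; rewrite /= /inner_arc /hr -qy.
  + by case=> -[k Tk []] // <- <-; split=> //; [right|left].
- move=> a [k /(max_lt' M) yk <-] [l Tl [ky _]].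
  by rewrite ky in yk; lia.
- by move=> a [k _ <-] [l _ []].
- by move=> a [k _ <-] [l _ []].
Qed.

Lemma periodic_modz (a : int -> int) (n : nat) (i : int) : (0 < n)%N ->
  (forall i, a (i + n%:Z) = a i) -> a (1 + ((i - 1) %% n%:Z)%Z) = a i.
Proof.
move=> n0 per.
have per_nat k (l : nat) : a (k + l%:Z * n%:Z) = a k.
  by elim: l => [|l IH]; rewrite ?mul0r ?addr0 // intS mulrDl mul1r [n%:Z + _]addrC addrA per.
have per_int k (z : int) : a (k + z * n%:Z) = a k.
  case: (intP z) => [|l|l]; [exact: (per_nat k 0%N) | exact: per_nat |].
  by rewrite -(per_nat (k + _) l.+1) mulNr subrK.
rewrite -[LHS](per_int _ ((i - 1) %/ n%:Z)%Z); congr a.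
by rewrite -addrA [X in 1 + X]addrC -divz_eq addrC subrK.
Qed.

(** Labels start at 1 and positions at 0, hence the residue of [i - 1]; periodicity then replaces
    the label in [1..n] by [i]. *)
Lemma nth_quiddity (t : int -> nat) (a : int -> int) (n : nat) (i : int) :
  (0 < n)%N -> (forall k, (t k)%:Z = a k) -> (forall k, a (k + n%:Z) = a k) ->
  (nth 0%N [seq t j%:Z | j <- iota 1 n] `|((i - 1) %% n%:Z)%Z|%N)%:Z = a i.
Proof.
move=> n0 ta per; have mod_ge0 : 0 <= ((i - 1) %% n%:Z)%Z by rewrite modz_ge0; lia.
have mod_lt : ((i - 1) %% n%:Z)%Z < n%:Z by rewrite ltz_pmod; lia.
have lt : (`|((i - 1) %% n%:Z)%Z|%N < n)%N by rewrite -ltz_nat gez0_abs.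
rewrite (nth_map 0%N) ?size_iota // nth_iota // ta PoszD gez0_abs //.
exact: periodic_modz.
Qed.

Theorem theorem3p4 (n m : nat) (hn : (1 <= n)%N) (hm : (1 <= m)%N)
    (T : set strip_arc) (hT : triangulation n m T)
    (F Fbar : int -> int -> int)
    (hF : generates (outer_quiddity n T) F)
    (hFbar : generates (inner_quiddity m T) Fbar) :
  frieze_s (outer_quiddity n T) F = frieze_s (inner_quiddity m T) Fbar.
Proof.
have M := triangulation_maximal hn hm hT; have S := maximal_strip M hn hm.
have [x [y Bxy]] := maximal_bridge M hn hm.
move: hF hFbar => [Ffr Fq] [F'fr F'q].
rewrite /frieze_s !size_map !size_iota.
rewrite !size_map !size_iota in Fq F'q.
apply: (strip_system_trace hn hm S Bxy Ffr _ F'fr) => i.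
- rewrite Fq; apply: (nth_quiddity (t := fun j => triangles_at T (Outer j))) => // k.
    exact: (triangles_at_outer _ hn hm hT).
  exact: (strip_degree_per _ hn S).
- rewrite F'q; apply: (nth_quiddity (t := fun j => triangles_at T (Inner j))) => // k.
    exact: (triangles_at_inner _ hn hm hT).
  exact: (strip_degree_per _ hm (strip_system_swap S)).
Qed.
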